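(* Let $q = p^r$ be a prime power ($p$ prime, $r \ge 1$), let $n \ge 1$ be an integer, and fix an integer $d \ge 0$. Then the average number of zeros of a random polynomial in $\mathbb{F}_q[x_1, \ldots, x_n]_{(d,\ldots,d)}$ is $q^{n-1}$; that is, $$\frac{1}{\left|\mathbb{F}_q[x_1,\ldots,x_n]_{(d,\ldots,d)}\right|} \sum_{f \in \mathbb{F}_q[x_1,\ldots,x_n]_{(d,\ldots,d)}} \left|\{\mathbf{p} \in \mathbb{F}_q^n : f(\mathbf{p}) = 0\}\right| = q^{n-1}.$$
   Context: $\mathbb{F}_q$ is the finite field with $q$ elements. For $d \ge 0$, $\mathbb{F}_q[x_1,\ldots,x_n]_{(d,\ldots,d)}$ denotes the set of polynomials in $n$ variables over $\mathbb{F}_q$ whose degree in each variable $x_i$ is at most $d$ (including the zero polynomial); it is an $\mathbb{F}_q$-vector space of dimension $(d+1)^n$. A random polynomial is chosen uniformly from this finite set. A zero of $f$ is a point $\mathbf{p} \in \mathbb{F}_q^n$ with $f(\mathbf{p}) = 0$; zeros are counted without multiplicity. *)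

(* Defs.v *)
From HB Require Import structures.
From mathcomp Require Import all_boot all_algebra.
From mathcomp Require Import mpoly.

Set Implicit Arguments.
Unset Strict Implicit.
Unset Printing Implicit Defensive.

Import GRing.Theory.
Local Open Scope ring_scope.

(* Partial degree in 'X_i; with this convention the zero polynomial has
   degree 0 in every variable. *)
Definition mdegvar (n : nat) (R : nzRingType) (i : 'I_n) (f : {mpoly R[n]}) : nat :=
  \max_(m <- msupp f) m i.

Definition mdegvar_le (n : nat) (R : nzRingType) (d : nat) : pred {mpoly R[n]} :=
  fun f => [forall i : 'I_n, mdegvar i f <= d]%N.

Record bddmpoly (n : nat) (R : nzRingType) (d : nat) : Type := BddMpoly {
  bddmpoly_val :> {mpoly R[n]};
  bddmpoly_bound : mdegvar_le d bddmpoly_val }.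

HB.instance Definition _ (n : nat) (R : nzRingType) (d : nat) :=
  [isSub for @bddmpoly_val n R d].
HB.instance Definition _ (n : nat) (R : nzRingType) (d : nat) :=
  [Choice of bddmpoly n R d by <:].

Lemma mdegvar_leP (n : nat) (R : nzRingType) (d : nat) (f : {mpoly R[n]}) :
  reflect (forall m : 'X_{1..n}, f@_m != 0 -> forall i, (m i <= d)%N)
          (mdegvar_le d f).
Proof.
apply: (iffP forallP) => [h m fm i | h i].
- apply: leq_trans (h i); rewrite /mdegvar (@leq_bigmax_seq _ _ _ (fun m : 'X_{1..n} => m i : nat)) //.
  by rewrite mcoeff_msupp.
- by apply/bigmax_leqP_seq => m; rewrite mcoeff_msupp => /h/(_ i).
Qed.

(* A polynomial with all partial degrees at most d is determined by its
   coefficients at the exponents in {0,...,d}^n. *)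
Definition bddmpoly_coef (n : nat) (R : nzRingType) (d : nat) (f : bddmpoly n R d) :
    {ffun {ffun 'I_n -> 'I_d.+1} -> R} :=
  [ffun e : {ffun 'I_n -> 'I_d.+1} => (bddmpoly_val f)@_[multinom (e i : nat) | i < n]].

Definition mpoly_of_coef (n : nat) (R : nzRingType) (d : nat)
    (c : {ffun {ffun 'I_n -> 'I_d.+1} -> R}) : {mpoly R[n]} :=
  \sum_e c e *: 'X_[[multinom (e i : nat) | i < n]].

Lemma mpoly_of_coefE (n : nat) (R : nzRingType) (d : nat)
    (c : {ffun {ffun 'I_n -> 'I_d.+1} -> R}) (e : {ffun 'I_n -> 'I_d.+1}) :
  (mpoly_of_coef c)@_[multinom (e i : nat) | i < n] = c e.
Proof.
rewrite /mpoly_of_coef raddf_sum /= (bigD1 e) //= mcoeffZ mcoeffX eqxx mulr1.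
rewrite big1 ?addr0 // => e' ne; rewrite mcoeffZ mcoeffX.
case: eqP => [/mnmP eqm|]; last by rewrite mulr0.
case/eqP: ne; apply/ffunP => i; apply/val_inj.
by have := eqm i; rewrite !mnmE.
Qed.

Lemma mpoly_of_coef_bound (n : nat) (R : nzRingType) (d : nat)
    (c : {ffun {ffun 'I_n -> 'I_d.+1} -> R}) : mdegvar_le d (mpoly_of_coef c).
Proof.
apply/mdegvar_leP => m nz i; apply: contraNT nz; rewrite -ltnNge => lt.
rewrite /mpoly_of_coef raddf_sum /= big1 // => e _; rewrite mcoeffZ mcoeffX.
case: eqP => [em|]; last by rewrite mulr0.
by move: lt; rewrite -em mnmE ltnNge -ltnS ltn_ord.
Qed.

Definition bddmpoly_of_coef (n : nat) (R : nzRingType) (d : nat)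
    (c : {ffun {ffun 'I_n -> 'I_d.+1} -> R}) : bddmpoly n R d :=
  BddMpoly (mpoly_of_coef_bound c).

Lemma bddmpoly_coefK (n : nat) (R : nzRingType) (d : nat) :
  cancel (@bddmpoly_coef n R d) (@bddmpoly_of_coef n R d).
Proof.
move=> f; apply/val_inj/mpolyP => m /=.
case: (boolP [forall i, m i <= d]%N) => [/forallP md|md].
  have -> : m = [multinom ([ffun i => inord (m i)] i : 'I_d.+1) : nat | i < n].
    by apply/mnmP => i; rewrite mnmE ffunE inordK // ltnS.
  by rewrite mpoly_of_coefE ffunE.
have z (g : bddmpoly n R d) : (bddmpoly_val g)@_m = 0.
  apply/eqP; apply: contraNT md => nz; apply/forallP => i.
  by have /mdegvar_leP/(_ m nz i) := bddmpoly_bound g.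
by rewrite (z f) (z (bddmpoly_of_coef (bddmpoly_coef f))).
Qed.

Lemma bddmpoly_of_coefK (n : nat) (R : nzRingType) (d : nat) :
  cancel (@bddmpoly_of_coef n R d) (@bddmpoly_coef n R d).
Proof. by move=> c; apply/ffunP => e; rewrite ffunE mpoly_of_coefE. Qed.

HB.instance Definition _ (n : nat) (R : finNzRingType) (d : nat) :=
  CanIsCountable (@bddmpoly_coefK n R d).
HB.instance Definition _ (n : nat) (R : finNzRingType) (d : nat) :
    isFinite (bddmpoly n R d) := CanIsFinite (@bddmpoly_coefK n R d).

Lemma card_bddmpoly (n : nat) (R : finNzRingType) (d : nat) :
  #|{: bddmpoly n R d}| = (#|R| ^ (d.+1 ^ n))%N.
Proof.
rewrite (bij_eq_card (Bijective (@bddmpoly_coefK n R d) (@bddmpoly_of_coefK n R d))).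
by rewrite !card_ffun !card_ord.
Qed.

Definition zeros (n : nat) (F : finFieldType) (f : {mpoly F[n]}) :
    {set {ffun 'I_n -> F}} :=
  [set a : {ffun 'I_n -> F} | f.@[a] == 0].

(* Main.v *)
Require Import Defs.
From mathcomp Require Import all_boot all_algebra.
From mathcomp Require Import mpoly.

(** The average is computed by exchanging the two summations: instead of
    counting the zeros of each polynomial, count for each point [a] the
    polynomials that vanish at [a].  The constants lie in the space of
    polynomials of bounded partial degrees, so adding a constant [c] permutes
    this space and carries the polynomials with value [0] at [a] onto those
    with value [c] ([card_meval_fiber]).  With [q] the size of the field, all
    [q] fibres of the evaluation at [a] thus have the same size, and exactly
    one polynomial in [q] vanishes at [a] ([card_vanishing]).  Summing over
    the [q ^ n] points, the zeros of all polynomials together number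
    [q ^ n / q] times the number of polynomials
    ([sum_card_zeros]). *)

Import GRing.Theory.
Local Open Scope ring_scope.

Lemma mdegvar_le_addC {n d : nat} {R : nzRingType} (c : R) (f : {mpoly R[n]}) :
  mdegvar_le d f -> mdegvar_le d (f + c%:MP).
Proof.
move=> /mdegvar_leP f_le; apply/mdegvar_leP => m.
rewrite mcoeffD mcoeffC; have [<- _ i|_] := eqVneq 0%MM m; first by rewrite mnmE.
by rewrite mulr0 addr0; apply: f_le.
Qed.

Definition bddmpoly_addC {n d : nat} {R : nzRingType} (c : R)
    (f : bddmpoly n R d) : bddmpoly n R d :=
  BddMpoly (mdegvar_le_addC c _ (bddmpoly_bound f)).

Lemma bddmpoly_addC_inj {n d : nat} {R : nzRingType} (c : R) :
  injective (@bddmpoly_addC n d R c).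
Proof. by move=> f g /(congr1 val) /addIr fg; apply: val_inj. Qed.

Lemma card_meval_fiber {n d : nat} {R : finComNzRingType}
    (a : {ffun 'I_n -> R}) (c : R) :
  #|[set f : bddmpoly n R d | f.@[a] == c]| =
  #|[set f : bddmpoly n R d | f.@[a] == 0]|.
Proof.
rewrite -(card_preimset _ (@bddmpoly_addC_inj n d R c)).
apply: eq_card => f; rewrite !inE /= mevalD mevalC.
by rewrite -[eqbRHS]add0r (inj_eq (addIr c)).
Qed.

Lemma card_vanishing {n d : nat} {R : finComNzRingType}
    (a : {ffun 'I_n -> R}) :
  (#|R| * #|[set f : bddmpoly n R d | f.@[a] == 0%R]|)%N = #|{: bddmpoly n R d}|.
Proof.
rewrite -[RHS]sum1_card.
rewrite (partition_big (fun f : bddmpoly n R d => f.@[a]) xpredT) //=.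
rewrite -sum_nat_const; apply: eq_bigr => c _.
by rewrite sum1dep_card (card_meval_fiber a c).
Qed.

(** The double count of the pairs (polynomial, zero), with both sides
    multiplied by [q] so that no division occurs. *)
Lemma sum_card_zeros (n d : nat) (F : finFieldType) :
  (#|F| * \sum_(f : bddmpoly n F d) #|zeros f|)%N =
  (#|F| ^ n * #|{: bddmpoly n F d}|)%N.
Proof.
have -> : (\sum_(f : bddmpoly n F d) #|zeros f|)%N =
    (\sum_(a : {ffun 'I_n -> F}) #|[set f : bddmpoly n F d | f.@[a] == 0%R]|)%N.
  under eq_bigr => f _ do rewrite -sum1dep_card big_mkcond /=.
  rewrite exchange_big; apply: eq_bigr => a _.
  by rewrite -sum1dep_card [RHS]big_mkcond.
rewrite big_distrr /=; under eq_bigr => a _ do rewrite card_vanishing.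
by rewrite sum_nat_const card_ffun card_ord.
Qed.

Theorem theorem2p3 (p r n d : nat) (F : finFieldType)
    (p_prime : prime p) (r_gt0 : (0 < r)%N) (cardF : #|F| = (p ^ r)%N)
    (n_gt0 : (0 < n)%N) :
  (#|{: bddmpoly n F d}|%:R)^-1 *
    (\sum_(f : bddmpoly n F d) #|zeros f|%:R) = (p ^ r)%:R ^+ (n - 1) :> rat.
Proof.
have q_gt0 : (0 < #|F|)%N by rewrite cardF expn_gt0 prime_gt0.
have B_neq0 : #|{: bddmpoly n F d}|%:R != 0 :> rat.
  by rewrite Num.Theory.pnatr_eq0 card_bddmpoly -lt0n expn_gt0 q_gt0.
rewrite -cardF; apply: (canLR (mulKf B_neq0)).
rewrite -natr_sum -natrX -natrM; congr _%:R.
apply/eqP; rewrite -(eqn_pmul2l q_gt0) sum_card_zeros.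
by rewrite mulnCA -expnS subn1 prednK // mulnC.
Qed.
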